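(* Let $(P_n)_{n\ge0}$ be a monic orthogonal polynomial sequence (MOPS) and let $(\beta_n)_{n\ge0}$ and $(\gamma_n)_{n\ge1}$ be the corresponding sequences of recurrence coefficients. Define recursively a sequence $(Q_n)_{n\ge0}$ of monic polynomials by $$Q_n(x)+r_nQ_{n-1}(x)=P_n(x)+s_nP_{n-1}(x)+t_nP_{n-2}(x),\qquad n\ge0,$$ where $(r_n)_{n\ge0}$, $(s_n)_{n\ge0}$, $(t_n)_{n\ge0}$ are sequences of complex numbers with $r_0=s_0=t_0=t_1=0$ and such that $$t_2\ne r_2(s_1-r_1),\qquad r_nt_n\neq0\quad (n\ge3).$$ Set $$\widetilde\beta_n:=\beta_n+s_n-s_{n+1}-r_n+r_{n+1},\quad n\ge0,$$ $$\widetilde\gamma_n:=\gamma_n+t_n-t_{n+1}+s_n(s_{n+1}-s_n-\beta_n+\beta_{n-1})-r_n(r_{n+1}-r_n-\widetilde\beta_n+\widetilde\beta_{n-1}),\quad n\ge1,$$ and $$a_n:=\gamma_n+t_n-t_{n+1}+s_n(s_{n+1}-s_n-\beta_n+\beta_{n-1}),\quad n\ge1,$$ $$b_n:=s_n\gamma_{n-1}+t_n(s_{n+1}-s_n-\beta_n+\beta_{n-2}),\quad n\ge2,$$ $$c_n:=t_n\gamma_{n-2},\quad n\ge3,\qquad\qquad d_n:=r_n\widetilde\gamma_{n-1},\quad n\ge2.$$ Then $(Q_n)_n$ is a MOPS with recurrence coefficients $(\widetilde\beta_n)_n$ and $(\widetilde\gamma_n)_n$ if and only if $\widetilde\gamma_1\widetilde\gamma_2\ne0$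 and the following equations hold: $$b_2-d_2=a_2(s_1-r_1),$$ $$b_3-d_3=a_3(s_2-r_2),$$ $$c_3-b_3(s_1-r_1)=a_3[t_2-s_2(s_1-r_1)],$$ $$b_n=a_ns_{n-1},\qquad c_n=a_nt_{n-1},\qquad d_n=a_nr_{n-1},\qquad n\ge4.$$
   Context: A MOPS is a sequence $(R_n)_{n\ge0}$ of monic complex polynomials, $\deg R_n=n$, for which there is a linear functional $\mathbf w$ on the space of complex polynomials (called regular) with $\langle\mathbf w,R_nR_m\rangle=0$ for $n\neq m$ and $\langle\mathbf w,R_n^2\rangle\neq0$ for all $n$. Its recurrence coefficients are the complex sequences $(\beta_n)_{n\ge0}$, $(\gamma_n)_{n\ge1}$, with $\gamma_n\ne0$ for all $n\ge1$, such that $R_{n+1}(x)=(x-\beta_n)R_n(x)-\gamma_nR_{n-1}(x)$, $n\ge0$, with $R_0=1$, $R_{-1}=0$. Polynomials with negative index are zero. *)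

(* Defs.v *)
From mathcomp Require Import all_boot all_order all_algebra.

Set Implicit Arguments.
Unset Strict Implicit.
Unset Printing Implicit Defensive.

Import GRing.Theory.
Local Open Scope ring_scope.

(* [shift R k n] is R_(n-k), with the convention that polynomials with negative
   index are zero; a bare [R (n - k)%N] would truncate the index to 0. *)
Definition shift (K : fieldType) (R : nat -> {poly K}) (k n : nat) : {poly K} :=
  if (k <= n)%N then R (n - k)%N else 0.

Definition is_MOPS (K : fieldType) (R : nat -> {poly K}) : Prop :=
  (forall n, R n \is monic /\ size (R n) = n.+1) /\
  exists w : {scalar {poly K}},
    (forall n m, n <> m -> w (R n * R m) = 0) /\
    (forall n, w (R n ^+ 2) <> 0).

(* The sequence gamma is indexed from 1; its value at 0 is irrelevant, being
   multiplied by R_(-1) = 0. *)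
Definition recurrence_coefficients (K : fieldType) (R : nat -> {poly K})
    (beta gamma : nat -> K) : Prop :=
  [/\ R 0%N = 1,
      forall n, (1 <= n)%N -> gamma n <> 0
    & forall n, R n.+1 =
        ('X - (beta n)%:P) * R n - gamma n *: shift R 1 n].

Definition MOPS_with (K : fieldType) (R : nat -> {poly K})
    (beta gamma : nat -> K) : Prop :=
  is_MOPS R /\ recurrence_coefficients R beta gamma.

(* The coefficients below are total functions of n, but are only meaningful for
   n large enough that no index is truncated: n >= 1 for [gamma_tilde] and
   [a_coef], n >= 2 for [b_coef] and [d_coef], n >= 3 for [c_coef]. *)
Definition beta_tilde (K : fieldType) (beta r s : nat -> K) (n : nat) : K :=
  beta n + s n - s n.+1 - r n + r n.+1.

Definition a_coef (K : fieldType) (beta gamma s t : nat -> K) (n : nat) : K :=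
  gamma n + t n - t n.+1 + s n * (s n.+1 - s n - beta n + beta (n - 1)%N).

Definition gamma_tilde (K : fieldType) (beta gamma r s t : nat -> K)
    (n : nat) : K :=
  gamma n + t n - t n.+1 + s n * (s n.+1 - s n - beta n + beta (n - 1)%N)
  - r n * (r n.+1 - r n - beta_tilde beta r s n
           + beta_tilde beta r s (n - 1)%N).

Definition b_coef (K : fieldType) (beta gamma s t : nat -> K) (n : nat) : K :=
  s n * gamma (n - 1)%N + t n * (s n.+1 - s n - beta n + beta (n - 2)%N).

Definition c_coef (K : fieldType) (gamma t : nat -> K) (n : nat) : K :=
  t n * gamma (n - 2)%N.

Definition d_coef (K : fieldType) (beta gamma r s t : nat -> K) (n : nat) : K :=
  r n * gamma_tilde beta gamma r s t (n - 1)%N.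

(* Main.v *)
(* Let E_n = Q_(n+1) - (x - betat_n) Q_n + gammat_n Q_(n-1) be the defect in the
   expected recurrence for Q. Expanding with the recurrence for P gives E_0 = 0
   and
     E_n + r_n E_(n-1) = (d_n - a_n r_(n-1)) Q_(n-2)
                         + (a_n s_(n-1) - b_n) P_(n-2)
                         + (a_n t_(n-1) - c_n) P_(n-3)      (n >= 2),
   so all defects vanish iff all these right-hand sides do. For n >= 4 the three
   polynomials are linearly independent: the regular functional of P kills
   P_(n-2) and P_(n-3), but not Q_(n-2), because t_2 != r_2 (s_1 - r_1) and
   r_n != 0 for n >= 3. For n = 2, 3 one gets the exceptional equations. The
   equations for c and d then force gammat_n != 0 for n >= 3, and Favard's
   theorem makes Q orthogonal. *)
Require Import Defs.
From HB Require Import structures.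
From mathcomp Require Import all_boot all_order all_algebra.
From mathcomp Require Import ring.
From mathcomp Require Import complex reals.

Set Implicit Arguments.
Unset Strict Implicit.
Unset Printing Implicit Defensive.

Import GRing.Theory.
Local Open Scope ring_scope.

(** * Favard's theorem: from recurrence to orthogonality *)

Section Favard.
Variables (K : fieldType) (beta gamma : nat -> K).

(* The value w('X^k * R_n) forced by the recurrence and w(R_n) = [n = 0]. *)
Fixpoint mixed_moment (k n : nat) : K :=
  if k is k'.+1 then
    mixed_moment k' n.+1 + beta n * mixed_moment k' n
    + (if n is n'.+1 then gamma n * mixed_moment k' n' else 0)
  else (n == 0%N)%:R.

Definition moment_functional (p : {poly K}) : K :=
  \sum_(i < size p) p`_i * mixed_moment i 0.

(** Padding with zero coefficients gives the summands of a linear combination a common range of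
    summation. *)
Lemma moment_functionalE (N : nat) (p : {poly K}) : (size p <= N)%N ->
  moment_functional p = \sum_(i < N) p`_i * mixed_moment i 0.
Proof.
move=> leN; rewrite /moment_functional.
rewrite (big_ord_widen N (fun i => p`_i * mixed_moment i 0)) // big_mkcond /=.
apply: eq_bigr => i _; case: ltnP => // le_p_i.
by rewrite nth_default ?mul0r.
Qed.

Lemma moment_functional_is_linear : scalar moment_functional.
Proof.
move=> a p q; set N := maxn (size p) (size q).
have sp : (size p <= N)%N by rewrite leq_maxl.
have sq : (size q <= N)%N by rewrite leq_maxr.
have spq : (size (a *: p + q)%R <= N)%N.
  apply: leq_trans (size_polyD _ _) _; rewrite geq_max sq andbT.
  exact: leq_trans (size_scale_leq _ _) sp.
rewrite (moment_functionalE sp) (moment_functionalE sq)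
  (moment_functionalE spq) mulr_sumr -big_split /=.
by apply: eq_bigr => i _; rewrite coefD coefZ mulrDl mulrA.
Qed.

HB.instance Definition _ :=
  GRing.isLinear.Build K {poly K} K *%R moment_functional
    moment_functional_is_linear.

Lemma moment_functionalXn k : moment_functional 'X^k = mixed_moment k 0.
Proof.
rewrite /moment_functional size_polyXn big_ord_recr /= big1 => [|i _].
  by rewrite coefXn eqxx mul1r add0r.
by rewrite coefXn (ltn_eqF (ltn_ord i)) mul0r.
Qed.

(** Each decrement of [k] lowers the second index by at most one, so index 0 is out of reach in
    fewer than [n] steps. *)
Lemma mixed_moment_lt k n : (k < n)%N -> mixed_moment k n = 0.
Proof.
elim: k n => [|k IH] [|n] //= lt_kn.
by rewrite !IH ?mulr0 ?addr0 // ltnW // ltnW.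
Qed.

(** Only the descent by one at every step reaches index 0 in time; it collects the weights gamma_n,
    ..., gamma_1. *)
Lemma mixed_moment_diag n : mixed_moment n n = \prod_(i < n) gamma i.+1.
Proof.
elim: n => [|n IH]; first by rewrite big_ord0.
rewrite big_ord_recr /= (@mixed_moment_lt n n.+2) //.
rewrite (@mixed_moment_lt n n.+1) //.
by rewrite mulr0 !add0r IH mulrC.
Qed.

Variable R : nat -> {poly K}.
Hypothesis recR : recurrence_coefficients R beta gamma.

Lemma recurrence_monic_size n : R n \is monic /\ size (R n) = n.+1.
Proof.
case: recR => R0 _ recS.
elim/ltn_ind: n => -[|n] IH; first by rewrite R0 monic1 size_poly1.
have [mon_n size_n] := IH n (ltnSn n).
have size_top : size (('X - (beta n)%:P) * R n) = n.+2.
  by rewrite size_Mmonic ?polyXsubC_eq0 // size_XsubC size_n.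
have size_low : (size (- (gamma n *: shift R 1 n)) < n.+2)%N.
  rewrite size_polyN ltnS; apply: leq_trans (size_scale_leq _ _) _.
  case: n IH {mon_n size_n size_top} => [|n] IH; first by rewrite size_poly0.
  by rewrite /shift /= subSS subn0 (IH n _).2 ?ltnS ?leqW.
rewrite recS; split; last by rewrite size_polyDl size_top.
rewrite monicE lead_coefDl ?size_top // -monicE.
by rewrite monicMl ?monicXsubC.
Qed.

(** The recurrence multiplied by ['X^k] is the recursion of [mixed_moment] solved for its index
    [n.+1]; hence the induction on [n] with [k] free. *)
Lemma moment_functionalXnM k n :
  moment_functional ('X^k * R n) = mixed_moment k n.
Proof.
case: recR => R0 _ recS.
elim/ltn_ind: n k => -[|n] IH k; first by rewrite R0 mulr1 moment_functionalXn.
have -> : 'X^k * R n.+1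
    = 'X^(k.+1) * R n - beta n *: ('X^k * R n)
      - gamma n *: ('X^k * shift R 1 n).
  by rewrite recS exprSr -!mul_polyC; ring.
rewrite !linearB !linearZ /= !IH //=.
case: n IH => [|n] IH; first by rewrite /shift /= mulr0 linear0; ring.
by rewrite /shift /= subSS subn0 IH //; ring.
Qed.

Lemma moment_functional_mul_le m n : (m <= n)%N ->
  moment_functional (R m * R n) = (m == n)%:R * \prod_(i < n) gamma i.+1.
Proof.
move=> le_mn; have [mon_m size_m] := recurrence_monic_size m.
rewrite -{1}[R m]coefK poly_def size_m mulr_suml linear_sum /=.
rewrite big_ord_recr big1 /= => [|i _].
  rewrite -scalerAl linearZ /= moment_functionalXnM add0r.
  have -> : (R m)`_m = 1 by move/monicP: mon_m; rewrite lead_coefE size_m.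
  rewrite mul1r; case: eqVneq => [->|ne_mn].
    by rewrite mixed_moment_diag mul1r.
  by rewrite mixed_moment_lt ?mul0r // ltn_neqAle ne_mn.
rewrite -scalerAl linearZ /= moment_functionalXnM mixed_moment_lt ?mulr0 //.
exact: leq_trans (ltn_ord i) le_mn.
Qed.

Lemma favard : is_MOPS R.
Proof.
split; first exact: recurrence_monic_size.
exists moment_functional; split=> [n m /eqP ne_nm|n].
  wlog le_nm : n m ne_nm / (n <= m)%N => [hwlog|].
    by case/orP: (leq_total n m) => /hwlog; rewrite 1?mulrC; apply;
       rewrite // eq_sym.
  by rewrite /= moment_functional_mul_le // (negPf ne_nm) mul0r.
case: recR => _ gamma_neq0 _.
rewrite expr2 /= moment_functional_mul_le // eqxx mul1r; apply/eqP/prodf_neq0.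
by move=> i _; apply/eqP/gamma_neq0.
Qed.

End Favard.

(** * Recurrence defects of [Q] *)

Section LinearlyRelated.
Variables (K : fieldType) (P Q : nat -> {poly K}).
Variables (beta gamma r s t : nat -> K).
Hypothesis hP : MOPS_with P beta gamma.
Hypotheses (r0 : r 0%N = 0) (s0 : s 0%N = 0) (t1 : t 1%N = 0).
Hypothesis t2 : t 2%N <> r 2%N * (s 1%N - r 1%N).
Hypothesis rt : forall n, (3 <= n)%N -> r n * t n <> 0.
Hypothesis hQ : forall n,
  Q n + r n *: shift Q 1 n = P n + s n *: shift P 1 n + t n *: shift P 2 n.

Let betat := beta_tilde beta r s.
Let gammat := gamma_tilde beta gamma r s t.
Let a := a_coef beta gamma s t.
Let b := b_coef beta gamma s t.
Let c := c_coef gamma t.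
Let d := d_coef beta gamma r s t.

Lemma shift1S (T : nat -> {poly K}) n : shift T 1 n.+1 = T n.
Proof. by rewrite /shift /= subSS subn0. Qed.

Lemma shiftSS (T : nat -> {poly K}) k n : shift T k.+1 n.+1 = shift T k n.
Proof. by rewrite /shift ltnS subSS. Qed.

Definition rec_defect n : {poly K} :=
  Q n.+1 - ('X - (betat n)%:P) * Q n + gammat n *: shift Q 1 n.

Lemma P_0 : P 0%N = 1. Proof. by case: hP => _ []. Qed.

Lemma Q_0 : Q 0%N = 1.
Proof.
have := hQ 0; rewrite /shift /= !scaler0 !addr0.
by rewrite P_0.
Qed.

Lemma Q_1 : Q 1%N = P 1%N + (s 1%N - r 1%N)%:P.
Proof.
have := hQ 1; rewrite /shift /= subnn Q_0 P_0 t1 scale0r addr0.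
by move/(canRL (addrK _)) => ->; rewrite -!mul_polyC; ring.
Qed.

Lemma P_1 : P 1%N = 'X - (beta 0%N)%:P.
Proof.
have [_ [_ _ recS]] := hP; rewrite recS P_0 /shift /= scaler0.
by rewrite mulr1 subr0.
Qed.

Lemma rec_defect0 : rec_defect 0 = 0.
Proof.
rewrite /rec_defect Q_0 Q_1 P_1 /betat /beta_tilde r0 s0 /shift /= scaler0.
by ring.
Qed.

(** The choice of [betat] cancels the P_(n+1) terms, and that of [gammat] leaves [a n.+1] in front
    of Q_n. *)
Lemma rec_defectS n :
  rec_defect n.+1 + r n.+1 *: rec_defect n
  = a n.+1 *: Q n + d n.+1 *: shift Q 1 n
    - (a n.+1 *: P n + b n.+1 *: shift P 1 n + c n.+1 *: shift P 2 n).
Proof.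
have [_ [_ _ recS]] := hP.
have Q2 := hQ n.+2; have Q1 := hQ n.+1.
have P2 := recS n.+1; have P1 := recS n.
(* For n = 0 the recurrence would read 1 = 0; the factor [t n.+1], which is then t_1 = 0, keeps the
   identity true. *)
have Pt : t n.+1 *: P n = t n.+1 *: (('X - (beta n.-1)%:P) * shift P 1 n
                                  - gamma n.-1 *: shift P 2 n).
  case: n {Q2 Q1 P2 P1} => [|n]; first by rewrite t1 !scale0r.
  by rewrite shift1S shiftSS /= -recS.
move: Q2 Q1 P2 P1 Pt; rewrite !(shiftSS _ 1) !shift1S.
rewrite /rec_defect !shift1S.
rewrite /a /b /c /d /d_coef /a_coef /b_coef /c_coef -/gammat.
have -> : gammat n.+1 = a n.+1
    - r n.+1 * (r n.+2 - r n.+1 - betat n.+1 + betat n).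
  by rewrite /a /a_coef /gammat /gamma_tilde subn1.
rewrite /a /a_coef /betat /beta_tilde !subSS !subn0 subn1 -/gammat.
rewrite -!mul_polyC => /(canRL (addrK _)) Q2 /(canRL (addrK _)) Q1 P2 P1.
move/eqP; rewrite -subr_eq0 => /eqP Pt.
apply/eqP; rewrite -subr_eq0; apply/eqP.
(* What remains is not formally zero but formally the difference in [Pt], which therefore replaces
   the 0 on the right. *)
rewrite -[RHS]Pt Q2 Q1 P2 P1.
move: (gammat n) => g.
by ring.
Qed.

Lemma rec_defectSS n :
  rec_defect n.+2 + r n.+2 *: rec_defect n.+1
  = (d n.+2 - a n.+2 * r n.+1) *: Q n + (a n.+2 * s n.+1 - b n.+2) *: P n
    + (a n.+2 * t n.+1 - c n.+2) *: shift P 1 n.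
Proof.
rewrite rec_defectS; have := hQ n.+1; rewrite !(shiftSS _ 1) !shift1S.
move/(canRL (addrK _)) => ->.
move: (a n.+2) (b n.+2) (c n.+2) (d n.+2) => a' b' c' d'.
by rewrite -!mul_polyC; ring.
Qed.

(** * Linear independence of Q_n, P_n and P_(n-1) for n >= 2 *)

Lemma P_monic n : P n \is monic. Proof. by case: hP => -[/(_ n) []]. Qed.

Lemma size_P n : size (P n) = n.+1. Proof. by case: hP => -[/(_ n) []]. Qed.

Lemma coef_P n : (P n)`_n = 1.
Proof. by have /monicP := P_monic n; rewrite lead_coefE size_P. Qed.

(** Applying [w] to [hQ] gives w(Q_2) = (t_2 - r_2 (s_1 - r_1)) w(1) and w(Q_(n+3)) = - r_(n+3)
    w(Q_(n+2)). *)
Lemma regular_functional_Q : exists w : {scalar {poly K}},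
  (forall n, w (P n.+1) = 0) /\ (forall n, w (Q n.+2) != 0).
Proof.
have [[_ [w [w_ortho w_neq0]]] _] := hP.
have w_P n : w (P n.+1) = 0.
  by rewrite -[P n.+1]mulr1 -P_0 w_ortho.
have w1 : w 1 != 0.
  by have /eqP := w_neq0 0%N; rewrite P_0 expr1n.
exists w; split=> //; elim=> [|n IH].
  have := hQ 2; rewrite (shiftSS _ 1) !shift1S Q_1 => /(canRL (addrK _)) ->.
  rewrite P_0 !(linearB, linearD) !linearZ /=.
  rewrite !w_P !mulr0 !add0r -alg_polyC linearZ /= mulrA -mulrBl mulf_neq0 //.
  by rewrite subr_eq0; apply/eqP.
have := hQ n.+3; rewrite !(shiftSS _ 1) !shift1S => /(canRL (addrK _)) ->.
rewrite !(linearB, linearD) !linearZ /= !w_P !mulr0 !add0r oppr_eq0.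
rewrite mulf_neq0 //.
by have /eqP := @rt n.+3 isT; rewrite mulf_eq0 negb_or => /andP[].
Qed.

Lemma P_comb_eq0 n u v : u *: P n.+1 + v *: P n = 0 -> u = 0 /\ v = 0.
Proof.
move=> comb0; have u0 : u = 0.
  have := congr1 (coefp n.+1) comb0; rewrite /= coefD !coefZ coef_P coef0.
  by rewrite (nth_default _ (n:=n.+1) (s:=P n)) ?size_P // mulr0 addr0 mulr1.
split=> //; have := congr1 (coefp n) comb0.
by rewrite /= u0 scale0r add0r coefZ coef_P coef0 mulr1.
Qed.

(** Q_(n+2) and P_(n+2) have equal degree, so degrees alone do not separate them; [w] isolates [u]
    first. *)
Lemma PQ_comb_eq0 n u v x :
  u *: Q n.+2 + v *: P n.+2 + x *: P n.+1 = 0 -> [/\ u = 0, v = 0 & x = 0].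
Proof.
move=> comb0; have [w [w_P w_Q]] := regular_functional_Q.
have u0 : u = 0.
  have := congr1 w comb0; rewrite !linearD !linearZ /= !w_P !mulr0 !addr0.
  by rewrite linear0 => /eqP; rewrite mulf_eq0 (negPf (w_Q n)) orbF => /eqP.
by move: comb0; rewrite u0 scale0r add0r => /P_comb_eq0 [].
Qed.

(** * Vanishing defects and the coefficient equations *)

Definition admissible : Prop :=
  [/\ b 2%N - d 2%N = a 2%N * (s 1%N - r 1%N),
      b 3%N - d 3%N = a 3%N * (s 2%N - r 2%N),
      c 3%N - b 3%N * (s 1%N - r 1%N)
        = a 3%N * (t 2%N - s 2%N * (s 1%N - r 1%N))
    & forall n, (4 <= n)%N ->
        [/\ b n = a n * s (n - 1)%N,
            c n = a n * t (n - 1)%N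
          & d n = a n * r (n - 1)%N]].

(** Since Q_0 = P_0 = 1 and P_(-1) = 0, only a constant is left: one equation instead of three. *)
Lemma rec_defect2 :
  rec_defect 2 + r 2%N *: rec_defect 1
  = (a 2%N * (s 1%N - r 1%N) - (b 2%N - d 2%N))%:P.
Proof.
rewrite rec_defectSS Q_0 P_0 /shift /= scaler0.
move: (a 2) (b 2) (d 2) => a' b' d'.
by rewrite -!mul_polyC; ring.
Qed.

(** Q_1 and P_1 differ by a constant, so the right-hand side lies in the span of P_1 and P_0: two
    equations instead of three. *)
Lemma rec_defect3 :
  rec_defect 3 + r 3%N *: rec_defect 2
  = (a 3%N * (s 2%N - r 2%N) - (b 3%N - d 3%N)) *: P 1%N
    + ((d 3%N - a 3%N * r 2%N) * (s 1%N - r 1%N)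
       + (a 3%N * t 2%N - c 3%N)) *: P 0%N.
Proof.
rewrite rec_defectSS shift1S Q_1 P_0.
move: (a 3) (b 3) (c 3) (d 3) => a' b' c' d'.
by rewrite -!mul_polyC; ring.
Qed.

Lemma rec_defect_eq0P : (forall n, rec_defect n = 0) <-> admissible.
Proof.
split=> [defect0 | [eq2 eq3 eq3' eq4]].
  split.
  - have := rec_defect2; rewrite !defect0 scaler0 addr0 => /esym/eqP.
    by rewrite polyC_eq0 subr_eq0 => /eqP.
  - have := rec_defect3; rewrite !defect0 scaler0 addr0 => /esym/P_comb_eq0[].
    by move/eqP; rewrite subr_eq0 => /eqP.
  - have := rec_defect3; rewrite !defect0 scaler0 addr0 => /esym/P_comb_eq0[].
    move: (a 3) (b 3) (c 3) (d 3) => a' b' c' d' e1 e2.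
    apply/eqP; rewrite -subr_eq0; apply/eqP.
    (* The equation is s_1 - r_1 times the P_1 coefficient [e1], minus the P_0 coefficient [e2]. *)
    transitivity ((s 1%N - r 1%N) * 0 - 0 : K); last by ring.
    by rewrite -{1}e1 -e2; ring.
  - case=> [|[|[|[|n]]]] // _; have := rec_defectSS n.+2.
    rewrite !defect0 scaler0 addr0 shift1S => /esym/PQ_comb_eq0 [].
    rewrite subn1 => /eqP + /eqP + /eqP; rewrite !subr_eq0.
    by move=> /eqP -> /eqP <- /eqP <-.
have step n : rec_defect n = 0 ->
    rec_defect n.+1 + r n.+1 *: rec_defect n = 0 -> rec_defect n.+1 = 0.
  by move=> ->; rewrite scaler0 addr0.
have E0 := rec_defect0.
(* Index 1 imposes no equation: the right-hand side is a_1 (Q_0 - P_0) = 0. *)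
have E1 : rec_defect 1 = 0.
  apply: step => //.
  by rewrite rec_defectS Q_0 P_0 /shift /= !scaler0 !addr0 subrr.
have E2 : rec_defect 2 = 0.
  by apply: step => //; rewrite rec_defect2 eq2 subrr.
have E3 : rec_defect 3 = 0.
  apply: step => //; rewrite rec_defect3 -eq3 subrr scale0r add0r.
  rewrite -[RHS](scale0r (P 0)); congr (_ *: _).
  move: eq3 eq3'; move: (a 3) (b 3) (c 3) (d 3) => a' b' c' d'.
  move=> /eqP; rewrite subr_eq addrC -subr_eq => /eqP <-.
  by move=> /eqP; rewrite subr_eq => /eqP ->; ring.
case=> [|[|[|]]] //; elim=> [//|n IH]; apply: step => //.
rewrite rec_defectSS shift1S; have [] := eq4 n.+4 isT.
by rewrite subn1 => -> -> ->; rewrite !subrr !scale0r !addr0.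
Qed.

(** For n >= 3, gammat_n = 0 gives d_(n+1) = 0, then a_(n+1) = 0 as r_n is nonzero, hence c_(n+1) =
    t_(n+1) gamma_(n-1) = 0, a contradiction. The equations from index 4 on do not reach n = 1,
    2. *)
Lemma admissible_gammat_neq0 : admissible -> gammat 1%N * gammat 2%N <> 0 ->
  forall n, (1 <= n)%N -> gammat n <> 0.
Proof.
move=> [_ _ _ eq4] g12 [|[|[|n]]] // _ g0.
- by apply: g12; rewrite g0 mul0r.
- by apply: g12; rewrite g0 mulr0.
have [_ eq_c eq_d] := eq4 n.+4 isT; rewrite subn1 /= in eq_c eq_d.
have [_ [_ gamma_neq0 _]] := hP.
have /eqP := @rt n.+3 isT; rewrite mulf_eq0 negb_or => /andP[r_neq0 _].
have /eqP := @rt n.+4 isT; rewrite mulf_eq0 negb_or => /andP[_ t_neq0].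
have a0 : a n.+4 = 0.
  move/esym/eqP: eq_d; rewrite /d /d_coef subn1 -/gammat g0 mulr0.
  by rewrite mulf_eq0 (negPf r_neq0) orbF => /eqP.
move/eqP: eq_c; rewrite a0 mul0r /c /c_coef mulf_eq0 (negPf t_neq0) /=.
by move/eqP; apply: gamma_neq0; rewrite subSS subSS.
Qed.

Lemma MOPS_with_admissibleP :
  MOPS_with Q betat gammat <-> gammat 1%N * gammat 2%N <> 0 /\ admissible.
Proof.
have defectE n : rec_defect n = 0 <->
    Q n.+1 = ('X - (betat n)%:P) * Q n - gammat n *: shift Q 1 n.
  rewrite /rec_defect; split=> [/eqP|->];
    last by rewrite addrAC subrK subrr.
  by rewrite addr_eq0 subr_eq addrC => /eqP.
split=> [[_ [_ g_neq0 recQ]]|[g12 adm]].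
  split; last by apply/rec_defect_eq0P => n; apply/defectE.
  by apply/eqP; rewrite mulf_neq0 //; apply/eqP/g_neq0.
have recQ : recurrence_coefficients Q betat gammat.
  split; [exact: Q_0 | exact: admissible_gammat_neq0 |].
  by move=> n; apply/defectE; move: n; apply/rec_defect_eq0P.
by split=> //; apply: favard recQ.
Qed.

End LinearlyRelated.

Theorem theorem3p1 (R : realType) (P Q : nat -> {poly R[i]})
    (beta gamma r s t : nat -> R[i])
    (hP : MOPS_with P beta gamma)
    (hr0 : r 0%N = 0) (hs0 : s 0%N = 0) (ht0 : t 0%N = 0) (ht1 : t 1%N = 0)
    (ht2 : t 2%N <> r 2%N * (s 1%N - r 1%N))
    (hrt : forall n, (3 <= n)%N -> r n * t n <> 0)
    (hQ : forall n, Q n + r n *: shift Q 1 n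
                    = P n + s n *: shift P 1 n + t n *: shift P 2 n) :
  let betat := beta_tilde beta r s in
  let gammat := gamma_tilde beta gamma r s t in
  let a := a_coef beta gamma s t in
  let b := b_coef beta gamma s t in
  let c := c_coef gamma t in
  let d := d_coef beta gamma r s t in
  MOPS_with Q betat gammat <->
  [/\ gammat 1%N * gammat 2%N <> 0,
      b 2%N - d 2%N = a 2%N * (s 1%N - r 1%N),
      b 3%N - d 3%N = a 3%N * (s 2%N - r 2%N),
      c 3%N - b 3%N * (s 1%N - r 1%N)
        = a 3%N * (t 2%N - s 2%N * (s 1%N - r 1%N))
    & forall n, (4 <= n)%N ->
        [/\ b n = a n * s (n - 1)%N,
            c n = a n * t (n - 1)%N
          & d n = a n * r (n - 1)%N]].
Proof.
move=> betat gammat a b c d.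
have := MOPS_with_admissibleP hP hr0 hs0 ht1 ht2 hrt hQ.
rewrite /admissible => ->.
by split=> [[? []]|[]] //; split.
Qed.
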